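(* Every integer $n > 2$ except for $n = 11$ can be written as $n = p + \eta$, where $p$ is a prime and $\eta$ is a square-free number which is co-prime to $3$.
   Context: A square-free number is a positive integer not divisible by the square of any prime; in particular $1$ is square-free. *)

(* Defs.v *)
From mathcomp Require Import all_boot.

Set Implicit Arguments.
Unset Strict Implicit.
Unset Printing Implicit Defensive.

(* [0 < m] is redundant (every square divides 0) but kept for readability. *)
Definition squarefree (m : nat) : Prop :=
  0 < m /\ forall q : nat, prime q -> ~~ (q ^ 2 %| m).

(* Main.v *)
(* Choose a class a modulo 12, prime to 12, with a <> n modulo 3 and modulo 4.
   For a prime p = a [mod 12] below n it only remains to avoid
   q ^ 2 %| n - p for primes q >= 5.

   Large n: both sides are weighted by ln p.  Let P = \prod_(j < J) (a + 12 j).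
   For p not dividing 12, the p-adic valuation of P exceeds that of J! by at most
   one for each power of p dividing a term of P.  When p itself divides
   a + 12 j = p m, the class of p is a m and p <= 12 J / (m %% 12), with
   m %% 12 in {1, 5, 7, 11}.  Hence (Erdos) ln (P / J!), about
   J (ln 12 + ln 2 + ln 3 / 2) after removal of the factors 2 and 3 of J!, is at
   most theta_a(12 J) + theta_5a(12 J / 5) + theta_7a(12 J / 7)
   + theta_11a(12 J / 11) + O(sqrt J ln J).  In the other direction
   P is divisible by the part of J! prime to k = 12 and by every prime p > J of
   the class, which bounds theta from above; since 1/5 + 1/7 + 1/11 < 1/2 the
   class a keeps a positive proportion.  The same upper bound with
   k = 12 q ^ 2 bounds the primes killed by q, and the sum over q >= 5 of
   (ln k + ln 2 + ln 3 / 2 + ln q / (q - 1)) / k is smaller.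

   Medium n: among the primes p = a [mod 12] below Y = 12 J <= n, a prime q kills
   at most J / q ^ 2 + 1, and only q <= sqrt n matter, so a table of primes up
   to Y settles all n from Y to about Y ^ 2 / 100. *)

Require Import Defs.
From mathcomp Require Import all_boot.
From mathcomp Require Import all_order all_algebra.
From mathcomp Require Import boolp reals exp Rstruct.
From mathcomp Require Import ring lra zify.

Set Implicit Arguments.
Unset Strict Implicit.
Unset Printing Implicit Defensive.

Import Order.TTheory GRing.Theory Num.Theory.

(** * Products over arithmetic progressions *)

(** For positive [c] the product is a falling factorial, that is, J! times a binomial
    coefficient. *)
Lemma dvdn_fact_prodn c J : J`! %| \prod_(j < J) (c + j).
Proof.
case: c => [|c].
  by case: J => [|J]; rewrite ?big_ord0 // big_ord_recl /= mul0n dvdn0.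
have -> : \prod_(j < J) (c.+1 + j) = (c + J) ^_ J.
  elim: J => [|J IH]; first by rewrite big_ord0 ffactn0.
  by rewrite big_ord_recr /= IH addnS ffactSS mulnC addSn.
by rewrite -bin_ffact dvdn_mull.
Qed.

Lemma dvdn_prod_AP k b J D :
  coprime k D -> D %| J`! -> D %| \prod_(j < J) (b + k * j).
Proof.
(* Modulo D the factor k is invertible, which reduces to consecutive integers. *)
move=> cokD DJ; have [D0|Dpos] := posnP D.
  by move: DJ; rewrite D0 dvd0n eqn0Ngt fact_gt0.
have [k' Hk'] : exists k', k * k' = 1 %[mod D].
  case: (posnP k) => [k0|kpos].
    by exists 0; move: cokD; rewrite k0 /coprime gcd0n => /eqP ->; rewrite !modn1.
  by case: (egcdnP D kpos) => u v E _; exists u; rewrite mulnC E (eqP cokD) modnMDl.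
have E : \prod_(j < J) (b + k * j) = k ^ J * \prod_(j < J) (k' * b + j) %[mod D].
  elim: J {DJ} => [|J IH]; first by rewrite !big_ord0.
  have key : b + k * J = k * (k' * b + J) %[mod D].
    rewrite mulnDr mulnA -[LHS]modnDml -[RHS]modnDml; congr ((_ + _) %% D).
    by rewrite -[RHS]modnMml Hk' modnMml mul1n.
  rewrite !big_ord_recr /= expnSr -[LHS]modnMm IH key modnMm.
  by rewrite mulnACA.
rewrite /dvdn E; exact: dvdn_mull (dvdn_trans DJ (dvdn_fact_prodn _ _)).
Qed.

Lemma prod_primes_dvd m N (Q : pred nat) :
  (forall p, p < N -> Q p -> prime p && (p %| m)) ->
  \prod_(p < N | Q p) p %| m.
Proof.
elim: N => [|N IH] H; first by rewrite big_ord0 dvd1n.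
rewrite big_mkcond big_ord_recr /= -big_mkcond /=.
have IH' := IH (fun p pN => H p (ltnW pN)).
case: ifP => [QN|_]; last by rewrite muln1.
have /andP[pr dv] := H N (ltnSn _) QN.
rewrite Gauss_dvd ?IH' //; apply: (big_ind (fun m => coprime m N)) => [|x y Cx Cy|i Qi].
- exact: coprime1n.
- by rewrite coprimeMl Cx.
have /andP[pri _] := H i (ltn_trans (ltn_ord i) (ltnSn _)) Qi.
by rewrite prime_coprime // dvdn_prime2 // neq_ltn ltn_ord.
Qed.

Lemma prime_dvd_fact p n : prime p -> p %| n`! -> p <= n.
Proof.
move=> pr; elim: n => [|n IH]; first by rewrite dvdn1 => /eqP p1; rewrite p1 in pr.
by rewrite factS Euclid_dvdM // => /orP[/dvdn_leq->//|/IH/leqW].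
Qed.

(** Chebyshev's argument for a progression. The primes of the class between [J] and [N] all occur
    among the terms b + k j, and [D] divides the product of these terms because [k] is invertible
    modulo [D]. The two divisors are coprime, since primes dividing J! are at most [J]. The product
    is at most k^J J!, and cancelling [D] leaves [M]. *)
Lemma prod_AP_upper k b J N D M :
  0 < b <= k -> J`! = D * M -> coprime k D -> N <= b + k * J ->
  \prod_(p < N | [&& prime p, p == b %[mod k] & J < p]) p <= k ^ J * M.
Proof.
move=> /andP[b0 bk] HJ cokD HN.
have Dpos : 0 < D by have := fact_gt0 J; rewrite HJ muln_gt0 => /andP[].
set S := \prod_(p < N | _) p; pose P := \prod_(j < J) (b + k * j).
have dS : S %| P.
  pose Q p := [&& prime p, p == b %[mod k] & J < p].
  apply: (@prod_primes_dvd _ _ Q) => p pN /and3P[pr /eqP pb Jp]; rewrite pr /=.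
  (* A prime below [b] would be its own residue, hence equal to [b]; the value b = k stands for the
     class 0 and would force p = 0. *)
  have bp : b <= p.
    rewrite leqNgt; apply/negP => pltb.
    move: pb; have pk := leq_trans pltb bk; rewrite (modn_small pk).
    have [bk'|bk'] := ltnP b k; first by rewrite modn_small // => E; rewrite E ltnn in pltb.
    have -> : b = k by apply/eqP; rewrite eqn_leq bk.
    by rewrite modnn => p0; rewrite p0 in Jp.
  have kp : k %| p - b by rewrite -eqn_mod_dvd // pb.
  have [j Ej] := dvdnP kp.
  have jJ : j < J by move: pN HN; rewrite -(subnK bp) Ej; nia.
  rewrite /P (bigD1 (Ordinal jJ)) //= [k * j]mulnC -Ej subnKC //.
  exact: dvdn_mulr.
have dD : D %| P by apply: dvdn_prod_AP => //; rewrite HJ dvdn_mulr.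
have cSD : coprime S D.
  rewrite /S; apply: (big_ind (fun m => coprime m D)) => [|x y Cx Cy|i /and3P[pr _ Ji]].
  - exact: coprime1n.
  - by rewrite coprimeMl Cx.
  rewrite prime_coprime //; apply/negP => iD.
  have : i %| J`! by rewrite HJ dvdn_mulr.
  by move/(prime_dvd_fact pr); rewrite leqNgt Ji.
have dSD : S * D %| P by rewrite Gauss_dvd // dS.
have P0 : 0 < P by rewrite prodn_gt0 // => j; rewrite addn_gt0 b0.
have PJ : P <= k ^ J * J`!.
  rewrite /P fact_prod -[X in k ^ X](card_ord J) -prod_nat_const.
  rewrite big_add1 /= big_mkord -big_split /=; apply: leq_prod => j _.
  by rewrite mulnS leq_add2r.
rewrite -(leq_pmul2r Dpos) -mulnA [M * D]mulnC -HJ.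
exact: leq_trans (dvdn_leq P0 dSD) PJ.
Qed.

(** Legendre's sum telescopes: p times the floor of J / p^k is at most the floor of J / p^(k-1). *)
Lemma logn_fact_le p J : prime p -> logn p J`! * p.-1 <= J.
Proof.
move=> pr; have p0 := prime_gt0 pr.
have H K : \sum_(1 <= k < K.+1) J %/ p ^ k * p.-1 + J %/ p ^ K <= J.
  elim: K => [|K IH]; first by rewrite big_geq // expn0 divn1.
  rewrite big_nat_recr //= -addnA; apply: leq_trans IH; rewrite leq_add2l.
  rewrite -[X in _ + X]muln1 -mulnDr addn1 prednK // expnSr divnMA.
  exact: leq_divM.
rewrite logn_fact // big_distrl /=; apply: leq_trans (H J); exact: leq_addr.
Qed.

(** Three terms of Legendre's sum have density 1/2 + 1/4 + 1/8 = 7/8, and each floor loses less than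
    1, whence 24 = 3 * 8. *)
Lemma logn2_fact_ge J : 7 * J <= 8 * logn 2 J`! + 24.
Proof.
rewrite logn_fact //; have [J3|J3] := ltnP J 3; first lia.
do 3 rewrite big_ltn 1?ltnS ?(leq_trans _ J3) //.
by move: (\sum_(_ <= _ < _) _) => s;
  change (2 ^ 1) with 2; change (2 ^ 2) with 4; change (2 ^ 3) with 8; lia.
Qed.

Lemma logn3_fact_ge J : 4 * J <= 9 * logn 3 J`! + 18.
Proof.
rewrite logn_fact //; have [J3|J3] := ltnP J 2; first lia.
do 2 rewrite big_ltn 1?ltnS ?(leq_trans _ J3) //.
by move: (\sum_(_ <= _ < _) _) => s; change (3 ^ 1) with 3; change (3 ^ 2) with 9; lia.
Qed.

(** Supplies the factorization J! = D M for the Chebyshev bound: [M] collects the primes of the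
    modulus. *)
Lemma pfactors_split (s : seq nat) m : 0 < m -> uniq s -> all prime s ->
  exists2 D, m = D * \prod_(p <- s) p ^ logn p m
           & all (fun p => coprime p D) s.
Proof.
move=> m0; elim: s => [|p s IH] /=.
  by exists m; rewrite // big_nil muln1.
case/andP=> ps us /andP[pr As]; have [D E C] := IH us As.
have D0 : 0 < D by move: m0; rewrite {1}E muln_gt0 => /andP[].
have [D' cop ED] := pfactor_coprime pr D0.
have L : logn p m = logn p D.
  have cs : coprime p (\prod_(q <- s) q ^ logn q m).
    elim: s {IH us E C} ps As => [|q s IH]; first by rewrite big_nil coprimen1.
    rewrite inE negb_or big_cons => /andP[pq ps] /= /andP[prq As].
    rewrite coprimeMr IH // andbT coprimeXr //.
    by rewrite prime_coprime // dvdn_prime2.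
  rewrite {1}E lognM ?(logn_coprime cs) ?addn0 //.
  by move: m0; rewrite {1}E muln_gt0 => /andP[].
exists D'; first by rewrite big_cons mulnA L -ED.
rewrite cop /=; apply/allP => q qs; have /allP/(_ q qs) := C.
by rewrite ED coprimeMr => /andP[].
Qed.

(** Congruent indices are told apart by their quotient by [d]. *)
Lemma card_congr_le J d (Q : pred 'I_J) : 0 < d ->
  (forall i j : 'I_J, Q i -> Q j -> i = j %[mod d]) -> #|Q| <= (J %/ d).+1.
Proof.
move=> d0 HQ; pose f (j : 'I_J) : 'I_(J %/ d).+1 := inord (j %/ d).
rewrite -[X in _ <= X]card_ord.
have fi : {in Q &, injective f}.
  move=> i j Qi Qj /(congr1 val); rewrite /= !inordK ?ltnS ?leq_div2r 1?ltnW // => E.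
  by apply: val_inj; rewrite /= (divn_eq i d) E (HQ _ _ Qi Qj) -divn_eq.
rewrite -(card_in_imset fi); exact: max_card.
Qed.

Lemma eqn_mod_coprime d k i j : coprime d k ->
  k * i = k * j %[mod d] -> i = j %[mod d].
Proof.
move=> cdk; wlog ij : i j / i <= j => [H E|].
  by have [ij|ji] := leqP i j; [exact: H|apply/esym/H => //; exact: ltnW].
move=> /esym/eqP; rewrite eqn_mod_dvd ?leq_mul2l ?ij ?orbT // -mulnBr Gauss_dvdr //.
by rewrite -eqn_mod_dvd // => /eqP.
Qed.

Lemma dvdn_AP_congr d k a i j : coprime d k ->
  d %| a + k * i -> d %| a + k * j -> i = j %[mod d].
Proof.
move=> cdk /eqP Hi /eqP Hj; apply: (eqn_mod_coprime cdk).
by apply/eqP; rewrite -(eqn_modDl a) Hi Hj.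
Qed.

(** The excess is an indicator rather than 1: at d = p it singles out the primes dividing some term,
    and these are what the lower bound for [theta] counts. *)
Lemma count_AP_le d k a J : 0 < d -> coprime d k ->
  \sum_(j < J) (d %| a + k * j) <= J %/ d + [exists j : 'I_J, d %| a + k * j].
Proof.
move=> d0 cdk; rewrite -big_mkcond /= sum1_card.
case: existsP => [_|H]; last first.
  rewrite eq_card0 // => j; apply/negP => Hj; apply: H; by exists j.
rewrite addn1; apply: card_congr_le => // i j; exact: dvdn_AP_congr.
Qed.

Lemma logn_dvd_sum p m N : prime p -> 0 < m <= N ->
  logn p m = \sum_(1 <= e < N) (p ^ e %| m).
Proof.
move=> pr /andP[m0 mN]; rewrite logn_count_dvd // [RHS](@big_cat_nat _ _ _ m) //=.
rewrite [X in _ = _ + X]big_nat_cond [X in _ = _ + X]big1 ?addn0 // => e /andP[/andP[me _] _].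
apply/eqP; rewrite eqb0; apply/negP => /(dvdn_leq m0); apply/negP; rewrite -ltnNge.
apply: leq_ltn_trans me _; exact: ltn_expl (prime_gt1 pr).
Qed.

Lemma logn_fact_sum p J N : prime p -> J < N ->
  logn p J`! = \sum_(1 <= e < N) J %/ p ^ e.
Proof.
move=> pr JN; rewrite logn_fact // [RHS](@big_cat_nat _ _ _ J.+1) //=.
rewrite [X in _ = _ + X]big_nat_cond [X in _ = _ + X]big1 ?addn0 // => e /andP[/andP[me _] _].
apply: divn_small; apply: ltn_trans me _; exact: ltn_expl (prime_gt1 pr).
Qed.

Lemma logn_prodn p J (F : nat -> nat) : (forall j, 0 < F j) ->
  logn p (\prod_(j < J) F j) = \sum_(j < J) logn p (F j).
Proof.
move=> F0; elim: J => [|J IH]; first by rewrite !big_ord0 logn1.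
by rewrite !big_ord_recr /= lognM ?prodn_gt0 // IH.
Qed.

(** For each exponent e, the number of terms divisible by p^e exceeds Legendre's term by at most
    one, and only if p^e <= N. The excess at e = 1 is kept as an indicator; the exponents from 2 on
    are counted by the logarithm. *)
Lemma logn_prod_AP_le p k a J N : prime p -> coprime p k -> 0 < a -> 0 < k ->
  a + k * J <= N ->
  logn p (\prod_(j < J) (a + k * j)) <=
    logn p J`! + [exists j : 'I_J, p %| a + k * j]
      + (p ^ 2 <= N) * trunc_log p N.
Proof.
move=> pr cpk a0 k0 HN; have p1 := prime_gt1 pr.
have JN : J < N by apply: leq_trans HN; rewrite -add1n leq_add // leq_pmull.
rewrite (@logn_prodn p J (fun j => a + k * j)) => [|j]; last by rewrite addn_gt0 a0.
rewrite (logn_fact_sum pr JN).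
have -> : \sum_(j < J) logn p (a + k * j) =
          \sum_(1 <= e < N) \sum_(j < J) (p ^ e %| a + k * j).
  rewrite exchange_big /=; apply: eq_bigr => j _; apply: logn_dvd_sum => //.
  rewrite addn_gt0 a0 (leq_trans _ HN) // leq_add2l leq_mul2l ltnW ?orbT //.
pose E e : nat := [exists j : 'I_J, p ^ e %| a + k * j].
apply: (@leq_trans (\sum_(1 <= e < N) (J %/ p ^ e + E e))).
  apply: leq_sum => e _; apply: count_AP_le; first by rewrite expn_gt0 prime_gt0.
  exact: coprimeXl.
rewrite big_split /= -addnA leq_add2l.
have [N1|N1] := leqP N 1; first by rewrite big_geq.
rewrite big_ltn // leq_add ?expn1 // /E ?expn1 //.
have EN e : 0 < E e -> p ^ e <= N.
  rewrite /E lt0b => /existsP[j /dvdn_leq]; rewrite addn_gt0 a0 => /(_ isT) H.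
  apply: leq_trans H (leq_trans _ HN); by rewrite leq_add2l leq_mul2l ltnW ?orbT.
have [pN|pN] := leqP (p ^ 2) N; last first.
  rewrite mul0n leqn0; apply/eqP; rewrite big_nat_cond big1 // => e /andP[/andP[e2 _] _].
  apply/eqP; rewrite eqb0; apply/negP => He; have := EN e; rewrite /E He => /(_ isT).
  by rewrite leqNgt (leq_trans pN) // leq_exp2l.
rewrite mul1n.
have -> : \sum_(2 <= e < N) E e = \sum_(2 <= e < N | e <= trunc_log p N) E e.
  rewrite [RHS]big_mkcond; apply: eq_bigr => e _; case: ifP => // /negbT; rewrite -ltnNge => te.
  apply/eqP; rewrite eqb0; apply/negP => He; have := EN e; rewrite /E He => /(_ isT).
  rewrite leqNgt => /negP; apply; apply: leq_trans (trunc_log_ltn N p1) _.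
  by rewrite leq_exp2l.
apply: (@leq_trans (\sum_(2 <= e < N | e <= trunc_log p N) 1)).
  by apply: leq_sum => e _; exact: leq_b1.
rewrite -big_filter sum1_size -[X in _ <= X](size_iota 1).
apply: uniq_leq_size => [|e]; first by rewrite filter_uniq ?iota_uniq.
by rewrite mem_filter mem_index_iota mem_iota add1n ltnS => /and3P[-> /ltnW -> _].
Qed.

(** Bounding the first term below by 1 and the later ones by k j leaves k^(J-1) (J-1)!, which the
    factor k J completes. *)
Lemma prod_AP_ge k a J : 0 < a -> 0 < J ->
  k ^ J * J`! <= \prod_(j < J) (a + k * j) * (k * J).
Proof.
move=> a0; case: J => // J _; elim: J => [|J IH].
  rewrite big_ord1 /= muln0 addn0 !muln1; exact: leq_pmull.
rewrite big_ord_recr factS expnS /=; move: IH.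
move: (\prod_(_ < _) _) (k ^ _) (_`!) => P K F IH.
have -> : k * K * (J.+2 * F) = K * F * (k * J.+2) by ring.
by rewrite leq_mul2r (leq_trans IH) ?orbT // leq_mul2l leq_addl orbT.
Qed.

(** Every unit modulo 12 is its own inverse, so p m = a gives p = a m. *)
Lemma class12_cofactor a p m :
  a \in [:: 1; 5; 7; 11] -> p * m = a %[mod 12] ->
  p = a * (m %% 12) %[mod 12] /\ m %% 12 \in [:: 1; 5; 7; 11].
Proof.
move=> aI; rewrite -modnMm => H.
have : all (fun x => all (fun y => all (fun c =>
   (x * y == c %[mod 12]) ==> ((x %% 12 == c * y %% 12) && (y \in [:: 1; 5; 7; 11])))
   [:: 1; 5; 7; 11]) (iota 0 12)) (iota 0 12) by [].
have mod12 x : x %% 12 \in iota 0 12 by rewrite mem_iota ltn_mod.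
move/(elimT allP)/(_ _ (mod12 p))/(elimT allP)/(_ _ (mod12 m)).
by move/(elimT allP)/(_ a aI); rewrite H eqxx modn_mod => /andP[/eqP ->].
Qed.

Lemma coprime_12_sqr q : prime q -> 4 < q -> coprime 12 (q ^ 2).
Proof.
move=> qpr q4; rewrite (_ : 12 = 2 ^ 2 * 3) // coprimeXr // coprimeMl coprimeXl.
  by rewrite prime_coprime // dvdn_prime2 // ltn_eqF // (ltn_trans _ q4).
by rewrite prime_coprime // dvdn_prime2 // ltn_eqF // (ltn_trans _ q4).
Qed.

Lemma sqrtn_spec n : exists s, s ^ 2 <= n < s.+1 ^ 2.
Proof.
elim: n => [|n [s /andP[sn ns]]]; first by exists 0.
have [ns'|ns'] := ltnP n.+1 (s.+1 ^ 2); first by exists s; rewrite ns' leqW.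
by exists s.+1; rewrite ns' /= (leq_ltn_trans ns) // ltn_exp2r.
Qed.

(** * Logarithms and the function theta *)

Section Analytic.
Local Open Scope ring_scope.

Definition lnn (R : realType) (m : nat) : R := ln m%:R.
Arguments lnn {R} m.

Lemma lnnM (R : realType) m n : (0 < m)%N -> (0 < n)%N ->
  lnn (m * n) = lnn m + lnn n :> R.
Proof. by move=> m0 n0; rewrite /lnn natrM lnM // posrE ltr0n. Qed.

Lemma lnn1 (R : realType) : lnn 1 = 0 :> R.
Proof. exact: ln1. Qed.

Lemma lnnX (R : realType) m e : (0 < m)%N -> lnn (m ^ e) = e%:R * lnn m :> R.
Proof. by move=> m0; rewrite /lnn natrX lnXn ?ltr0n // mulr_natl. Qed.

Lemma ler_lnn (R : realType) m n : (0 < m <= n)%N -> lnn m <= lnn n :> R.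
Proof.
move=> /andP[m0 mn]; rewrite /lnn ler_ln ?posrE ?ltr0n ?ler_nat //.
exact: leq_trans mn.
Qed.

Lemma lnn_ge0 (R : realType) m : 0 <= lnn m :> R.
Proof.
by case: m => [|m]; [rewrite /lnn ln0 | rewrite -(lnn1 R) ler_lnn].
Qed.

Lemma lnn_prod (R : realType) (I : finType) (Q : pred I) (F : I -> nat) :
  (forall i, Q i -> (0 < F i)%N) ->
  lnn (\prod_(i | Q i) F i) = \sum_(i | Q i) lnn (F i) :> R.
Proof.
move=> F0; elim/(big_load (fun m => (0 < m)%N)): _.
apply: (big_ind2 (fun m (x : R) => (0 < m)%N /\ lnn m = x)).
- by rewrite lnn1.
- by move=> m x n y [m0 <-] [n0 <-]; rewrite muln_gt0 m0 n0 lnnM.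
- by move=> i Qi; split; [exact: F0|].
Qed.

Lemma prod_primes_pfactor m N : (0 < m)%N ->
  (forall p, prime p -> (p %| m)%N -> (p < N)%N) ->
  m = (\prod_(p < N | prime p) p ^ logn p m)%N.
Proof.
move=> m0 Hm; pose K := maxn m N.
have -> : (\prod_(p < N | prime p) p ^ logn p m =
  \prod_(0 <= p < K.+1 | p \in predT) p ^ logn p m)%N.
  rewrite -(big_mkord prime (fun p => p ^ logn p m)%N).
  rewrite [RHS](@big_cat_nat _ _ _ N) //=; last by rewrite /K leqW // leq_maxr.
  rewrite [X in _ = (_ * X)%N]big_nat_cond [X in _ = (_ * X)%N]big1 ?muln1; last first.
    move=> p /andP[/andP[Np _] _]; apply/eqP; rewrite -(expn0 p).
    have [->//|] := posnP (logn p m); rewrite logn_gt0 mem_primes.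
    by move=> /and3P[pr _ /(Hm _ pr)]; rewrite ltnNge Np.
  rewrite big_mkcond; apply: eq_bigr => p _; case: ifP => // np.
  by rewrite lognE np.
rewrite -[LHS](partnT m0) -widen_partn //; exact: leq_maxl.
Qed.

Lemma lnn_sum_primes (R : realType) m N : (0 < m)%N ->
  (forall p, prime p -> (p %| m)%N -> (p < N)%N) ->
  lnn m = \sum_(p < N | prime p) (logn p m)%:R * lnn p :> R.
Proof.
move=> m0 Hm; rewrite {1}(prod_primes_pfactor m0 Hm) lnn_prod; last first.
  by move=> p pr; rewrite expn_gt0 prime_gt0.
by apply: eq_bigr => p pr; rewrite lnnX ?prime_gt0.
Qed.

(** * Chebyshev's theta function in residue classes, with numerical bounds for logarithms *)

Definition theta (R : realType) (k b x : nat) : R :=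
  \sum_(p < x.+1 | prime p && (p == b %[mod k])%N) lnn p.

Lemma sum_AP_upper (R : realType) k b J N D M :
  (0 < b <= k)%N -> (J`! = D * M)%N -> coprime k D -> (N <= b + k * J)%N ->
  \sum_(p < N | [&& prime p, p == b %[mod k] & J < p]%N) lnn p
    <= J%:R * lnn k + lnn M :> R.
Proof.
move=> bk HJ cop HN; have := prod_AP_upper bk HJ cop HN => H.
have M0 : (0 < M)%N by have := fact_gt0 J; rewrite HJ muln_gt0 => /andP[].
have k0 : (0 < k)%N by case/andP: bk => /leq_trans; apply.
rewrite -lnnX // -lnnM ?expn_gt0 ?k0 // -lnn_prod; last first.
  by move=> p /and3P[/prime_gt0].
apply: ler_lnn; rewrite H prodn_cond_gt0 // => p /and3P[pr _ _].
exact: prime_gt0.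
Qed.

Lemma ln_le_subr1 (R : realType) (x : R) : 0 < x -> ln x <= x - 1.
Proof.
move=> x0; rewrite -{1}[x](addrNK 1) addrC; apply: le_ln1Dx; lra.
Qed.

Lemma ln_ge1BV (R : realType) (x : R) : 0 < x -> 1 - x^-1 <= ln x.
Proof.
move=> x0; have xV : 0 < x^-1 by rewrite invr_gt0.
have := ln_le_subr1 xV; rewrite lnV ?posrE //; lra.
Qed.

(** The bound ln y <= y - 1 is sharp only near 1, so it is applied to a base close to 1, a power of
    which dominates [x]. *)
Lemma ln_le_expn (R : realType) (x y t : R) k :
  0 < x -> 0 < y -> x <= y ^+ k -> k%:R * (y - 1) <= t -> ln x <= t.
Proof.
move=> x0 y0 xy kt; apply: (@le_trans _ _ (ln (y ^+ k))).
  by rewrite ler_ln ?posrE // exprn_gt0.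
rewrite lnXn // -mulr_natl; apply: le_trans kt.
by rewrite ler_wpM2l // ln_le_subr1.
Qed.

Lemma ln_ge_expn (R : realType) (x y t : R) k :
  0 < x -> 0 < y -> y ^+ k <= x -> t <= k%:R * (1 - y^-1) -> t <= ln x.
Proof.
move=> x0 y0 xy kt; apply: (@le_trans _ _ (ln (y ^+ k))); last first.
  by rewrite ler_ln ?posrE // exprn_gt0.
rewrite lnXn // -[X in _ <= X]mulr_natl; apply: le_trans kt _.
by rewrite ler_wpM2l // ln_ge1BV.
Qed.

Lemma ln2_bounds (R : realType) : 692 / 1000 <= (ln 2 : R) <= 694 / 1000.
Proof.
apply/andP; split.
  (* (500/499)^346 <= 2 with 346/500 = 0.692, and 2 <= (501/500)^347 with 347/500 = 0.694. *)
  by apply: (@ln_ge_expn _ _ (500 / 499) _ 346); lra.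
by apply: (@ln_le_expn _ _ (501 / 500) _ 347); lra.
Qed.

Lemma ln3_bounds (R : realType) : 1096 / 1000 <= (ln 3 : R) <= 1100 / 1000.
Proof.
apply/andP; split.
  by apply: (@ln_ge_expn _ _ (500 / 499) _ 548); lra.
by apply: (@ln_le_expn _ _ (501 / 500) _ 550); lra.
Qed.

Lemma lnn12 (R : realType) : lnn 12 = 2 * ln 2 + ln 3 :> R.
Proof.
have -> : (12 = 2 ^ 2 * 3)%N by [].
by rewrite lnnM // lnnX.
Qed.

Lemma theta_split (R : realType) k b y x : (y <= x)%N ->
  theta R k b x = theta R k b y +
    \sum_(p < x.+1 | [&& prime p, p == b %[mod k] & y < p]%N) lnn p.
Proof.
move=> yx; rewrite /theta.
rewrite -(big_mkord (fun p => prime p && (p == b %[mod k])%N) lnn).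
rewrite -(big_mkord (fun p => [&& prime p, p == b %[mod k] & y < p]%N) lnn).
rewrite (@big_cat_nat _ _ _ y.+1) //= big_mkord; congr (_ + _).
rewrite [RHS](@big_cat_nat _ _ _ y.+1) //= [X in X + _]big_nat_cond.
rewrite [X in X + _]big1 ?add0r; last first.
  by move=> p /andP[/andP[_ py] /and3P[_ _]]; rewrite ltnNge -ltnS py.
rewrite big_nat_cond [RHS]big_nat_cond; apply: eq_bigl => p.
by case: (ltnP y p) => //= _; rewrite andbT.
Qed.

(* The induction passes from x %/ 12 + 1 to x, so 36 / 100 may be any constant
   above (ln 12 + ln 2 + ln 3 / 2) / 11 = 0.3389; 1600 absorbs x < 240. *)
Lemma theta_le (R : realType) b x :
  theta R 12 b x <= 36 / 100 * x%:R + 1600.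
Proof.
elim/ltn_ind: x => x IH; have [x240|x240] := ltnP x 240.
  apply: (@le_trans _ _ (\sum_(p < x.+1) 6)); last first.
    rewrite sumr_const card_ord -mulr_natr.
    have : (x.+1%:R <= 240 :> R) by rewrite ler_nat.
    have : (0 <= x%:R :> R) by [].
    lra.
  rewrite /theta big_mkcond; apply: ler_sum => p _; case: ifP => // /andP[pr _].
  apply: (@le_trans _ _ (lnn (2 ^ 8))).
    have px := ltn_ord p; apply: ler_lnn; rewrite prime_gt0 //=.
    by rewrite (leq_trans (ltnW px)) // ltnW // (leq_ltn_trans x240).
  rewrite lnnX // /lnn; have /andP[_] := ln2_bounds R; lra.
(* The Chebyshev bound takes representatives in 1..12, so 12 stands for the class 0. *)
pose b' := if (b %% 12 == 0)%N then 12%N else (b %% 12)%N.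
have b'12 : (0 < b' <= 12)%N.
  rewrite /b'; case: eqP => // b0; rewrite lt0n; apply/andP; split; first exact/eqP.
  by rewrite ltnW // ltn_mod.
have b'b : (b' = b %[mod 12])%N by rewrite /b'; case: eqP => [->|]; rewrite ?modn_mod.
pose J := (x %/ 12).+1.
have Jlt : (J < x)%N by rewrite /J; clear -x240; lia.
have Jle : (12 * J <= x + 12)%N by rewrite /J; clear; lia.
have [D ED /= /and3P[c2 c3 _]] := @pfactors_split [:: 2; 3] J`! (fact_gt0 J) isT isT.
have cD : coprime 12 D.
  by rewrite (_ : 12 = 2 * (2 * 3))%N // !coprimeMl c2 c3.
have xJ : (x.+1 <= b' + 12 * J)%N by rewrite /J; clear; lia.
have := sum_AP_upper R b'12 ED cD xJ.
rewrite !big_cons big_nil muln1 lnnM ?expn_gt0 // !lnnX // lnn12.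
rewrite -[lnn 2]/(ln 2) -[lnn 3]/(ln 3) => UP.
have v2 : ((logn 2 J`!)%:R <= J%:R :> R).
  by rewrite ler_nat; have := @logn_fact_le 2 J isT; rewrite muln1.
have v3 : (2 * (logn 3 J`!)%:R <= J%:R :> R).
  by rewrite -natrM ler_nat mulnC; have := @logn_fact_le 3 J isT.
have JR : 12 * J%:R <= x%:R + 12 :> R.
  by rewrite -natrM -natrD ler_nat.
have xR : 240 <= x%:R :> R by rewrite ler_nat.
have /andP[_ l2] := ln2_bounds R; have /andP[_ l3] := ln3_bounds R.
have /IH IHJ := Jlt.
suff : theta R 12 b x <= theta R 12 b J + J%:R * (2 * ln 2 + ln 3) +
   ((logn 2 J`!)%:R * ln 2 + (logn 3 J`!)%:R * ln 3).
  have l20 : 0 <= ln 2 :> R by apply: ln_ge0; rewrite ler1n.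
  have l30 : 0 <= ln 3 :> R by apply: ln_ge0; rewrite ler1n.
  have E2 := ler_pM (ler0n _ _) l20 v2 l2.
  have E3 := ler_pM (mulr_ge0 (ler0n _ 2) (ler0n _ _)) l30 v3 l3.
  have E12 : J%:R * (2 * ln 2 + ln 3) <= J%:R * (2488 / 1000) :> R.
    by rewrite ler_wpM2l //; clear -l2 l3; lra.
  clear -IHJ E2 E3 E12 JR xR; lra.
rewrite (theta_split R 12 b (ltnW Jlt)) -addrA lerD2l.
by move: UP; under eq_bigl do rewrite b'b.
Qed.

(** Only primes up to [s] contribute, each at most ln N because p raised to its truncated logarithm
    is at most N. *)
Lemma sum_prime_powers_le (R : realType) N s : (N < s.+1 ^ 2)%N ->
  \sum_(p < N | prime p) ((p ^ 2 <= N) * trunc_log p N)%:R * lnn p <= s%:R * lnn N :> R.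
Proof.
move=> Ns; apply: (@le_trans _ _ (\sum_(1 <= p < s.+1) lnn N)); last first.
  by rewrite sumr_const_nat subn1 mulr_natl.
rewrite -(big_mkord prime (fun p => ((p ^ 2 <= N) * trunc_log p N)%:R * lnn p)).
pose K := maxn N s.+1.
apply: (@le_trans _ _ (\sum_(0 <= p < K | (1 <= p < s.+1)%N) lnn N)); last first.
  rewrite [X in _ <= X](big_nat_widenl _ 0) //.
  rewrite [X in _ <= X](big_nat_widen _ _ K) //.
  exact: leq_maxr.
rewrite (big_nat_widen _ _ K) ?leq_maxl // big_mkcond [X in _ <= X]big_mkcond.
apply: ler_sum_nat => p _; case: ifP => [/andP[pr pN]|_]; last first.
  by case: ifP => // _; exact: lnn_ge0.
have p0 := prime_gt0 pr; have p1 := prime_gt1 pr.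
have [pN2|pN2] := leqP (p ^ 2)%N N; last first.
  by rewrite /= mul0n mul0r; case: ifP => // _; exact: lnn_ge0.
have -> : (1 <= p < s.+1)%N.
  by rewrite p0 -(@ltn_exp2r _ _ 2) // (leq_ltn_trans pN2).
rewrite mul1n -lnnX // ler_lnn // expn_gt0 p0 trunc_logP //.
exact: leq_ltn_trans pN.
Qed.

Lemma theta_widen (R : realType) k b x N : (x < N)%N ->
  theta R k b x =
    \sum_(p < N | prime p) ((p == b %[mod k])%N && (p <= x)%N)%:R * lnn p.
Proof.
move=> xN; rewrite /theta.
rewrite -(big_mkord (fun p => prime p && (p == b %[mod k])%N) lnn).
rewrite -(big_mkord prime (fun p => ((p == b %[mod k])%N && (p <= x)%N)%:R * lnn p)).
rewrite (big_nat_widen _ _ N) // big_mkcond [RHS]big_mkcond; apply: eq_bigr => p _.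
rewrite ltnS -andbA; case: ifP => [/andP[-> ->]|]; first by rewrite mul1r.
by case: prime => //= ->; rewrite mul0r.
Qed.

(** Erdos's comparison of the product of the terms with J!, prime by prime. Primes dividing some
    term contribute to one of the four [theta]; higher prime powers go into the term with [s]. *)
Lemma sum_theta_ge (R : realType) a J s :
  a \in [:: 1; 5; 7; 11]%N -> (0 < J)%N -> (12 * J + 12 < s.+1 ^ 2)%N ->
  J%:R * lnn 12 + (logn 2 J`!)%:R * ln 2 + (logn 3 J`!)%:R * ln 3 <=
  theta R 12 a (12 * J).-1 + theta R 12 (a * 5) (12 * J %/ 5)
    + theta R 12 (a * 7) (12 * J %/ 7) + theta R 12 (a * 11) (12 * J %/ 11)
    + lnn (12 * J) + s%:R * lnn (12 * J + 12).
Proof.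
move=> aI J0 Ns; set N := (12 * J + 12)%N in Ns *.
have [a0 [a12 ca]] : (0 < a)%N /\ (a < 12)%N /\ coprime a 12.
  by move: aI; rewrite !inE => /or4P[] /eqP ->.
pose P := (\prod_(j < J) (a + 12 * j))%N.
have P0 : (0 < P)%N by rewrite prodn_gt0 // => j; rewrite addn_gt0 a0.
(* [P] is prime to 6, so restoring the factors 2 and 3 of J! makes the valuations of [M] and J!
   agree at these primes. *)
pose M := (P * 2 ^ logn 2 J`! * 3 ^ logn 3 J`!)%N.
have M0 : (0 < M)%N by rewrite !muln_gt0 P0 !expn_gt0.
have PN (p : nat) : prime p -> (p %| P)%N ->
    exists2 j : 'I_J, (p %| a + 12 * j)%N & (p <= a + 12 * j)%N.
  move=> pr; rewrite Euclid_dvd_prod // big_has_cond => /hasP[j _ /= pj].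
  by exists j; rewrite // dvdn_leq // addn_gt0 a0.
have MN p : prime p -> (p %| M)%N -> (p < N)%N.
  move=> pr; rewrite !Euclid_dvdM // -orbA => /or3P[/(PN _ pr)[j _]|pM|pM].
  - by move=> pj; apply: leq_ltn_trans pj _; have := ltn_ord j; rewrite /N; clear -a12; lia.
  - have : (p <= 2)%N.
      by apply: dvdn_leq => //; move: pM; rewrite Euclid_dvdX // => /andP[].
    by rewrite /N; clear; lia.
  - have : (p <= 3)%N.
      by apply: dvdn_leq => //; move: pM; rewrite Euclid_dvdX // => /andP[].
    by rewrite /N; clear; lia.
have JN p : prime p -> (p %| J`!)%N -> (p < N)%N.
  by move=> pr /(prime_dvd_fact pr) pJ; apply: leq_ltn_trans pJ _; rewrite /N; clear; lia.
pose e1 p : nat := [exists j : 'I_J, p %| a + 12 * j]%N.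
have cP p : p \in [:: 2; 3]%N -> coprime p P.
  rewrite /P => p23; apply: (big_ind (fun m => coprime p m)) => [|x y Cx Cy|i _].
  - exact: coprimen1.
  - by rewrite coprimeMr Cx.
  by move: aI p23; rewrite !inE => /or4P[] /eqP -> /orP[] /eqP ->;
    rewrite prime_coprime //; clear; lia.
have MJ p : prime p ->
    (logn p M <= logn p J`! + e1 p + (p ^ 2 <= N) * trunc_log p N)%N.
  move=> pr; rewrite /M !lognM ?muln_gt0 ?expn_gt0 ?P0 // !lognX.
  rewrite (@logn_prime p 2 isT) (@logn_prime p 3 isT).
  have [p2|p2] := eqVneq p 2%N.
    by rewrite p2 (logn_coprime (cP _ _)) // muln1 muln0 addn0 add0n -addnA leq_addr.
  have [p3|p3] := eqVneq p 3%N.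
    by rewrite p3 (logn_coprime (cP _ _)) // muln1 muln0 !add0n -addnA leq_addr.
  rewrite !muln0 !addn0; apply: logn_prod_AP_le => //.
    by rewrite (_ : 12 = 2 ^ 2 * 3)%N // coprimeMr coprimeXr // !prime_coprime //
      !dvdn_prime2 // p2.
  by rewrite /N addnC leq_add2l ltnW.
have LM : lnn M <= lnn J`! + \sum_(p < N | prime p) (e1 p)%:R * lnn p + s%:R * lnn N :> R.
  rewrite (lnn_sum_primes R M0 MN) (lnn_sum_primes R (fact_gt0 J) JN).
  apply: le_trans (lerD (lexx _) (sum_prime_powers_le R Ns)).
  rewrite -!big_split /=; apply: ler_sum => p pr.
  rewrite -!mulrDl -!natrD ler_wpM2r ?lnn_ge0 // ler_nat; exact: MJ.
have LP : J%:R * lnn 12 + lnn J`! <= lnn P + lnn (12 * J) :> R.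
  rewrite -lnnX // -!lnnM ?muln_gt0 ?expn_gt0 ?fact_gt0 //.
  by rewrite ler_lnn // muln_gt0 expn_gt0 fact_gt0 prod_AP_ge.
have E1 : \sum_(p < N | prime p) (e1 p)%:R * lnn p <=
  theta R 12 a (12 * J).-1 + theta R 12 (a * 5) (12 * J %/ 5)
    + theta R 12 (a * 7) (12 * J %/ 7) + theta R 12 (a * 11) (12 * J %/ 11).
  have J5 : (12 * J %/ 5 < N)%N by rewrite /N; clear; lia.
  have J7 : (12 * J %/ 7 < N)%N by rewrite /N; clear; lia.
  have J11 : (12 * J %/ 11 < N)%N by rewrite /N; clear; lia.
  have J1 : ((12 * J).-1 < N)%N by rewrite /N; clear; lia.
  rewrite (theta_widen R 12 a J1) (theta_widen R 12 _ J5) (theta_widen R 12 _ J7).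
  rewrite (theta_widen R 12 _ J11) -!big_split /=; apply: ler_sum => p pr.
  rewrite -!mulrDl -!natrD ler_wpM2r ?lnn_ge0 // ler_nat /e1.
  case: existsP => // -[j /dvdnP[m Em]].
  have Em' : (p * m = a %[mod 12])%N by rewrite mulnC -Em addnC mulnC modnMDl.
  have [r12 Hr] := class12_cofactor aI Em'.
  (* As m %% 12 <= m, the cofactor may be replaced by its residue, which leaves only 1, 5, 7 and
     11. *)
  have mp : (p * (m %% 12) <= (12 * J).-1)%N.
    apply: (@leq_trans (a + 12 * j)); last by have := ltn_ord j; clear -a12; lia.
    by rewrite Em mulnC leq_mul2r leq_mod orbT.
  have pm r : (m %% 12 = r)%N -> (0 < r)%N -> (p <= 12 * J %/ r)%N.
    by move=> <- r0; rewrite leq_divRL // (leq_trans mp) // leq_pred.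
  have pm1 : (m %% 12 = 1)%N -> (p <= (12 * J).-1)%N.
    by move=> E; move: mp; rewrite E muln1.
  move: Hr; rewrite !inE => /or4P[] /eqP Hr; rewrite Hr ?muln1 in r12.
  - by rewrite r12 eqxx (pm1 Hr) lt0n !addn_eq0.
  - by rewrite r12 eqxx (pm _ Hr isT) lt0n !addn_eq0 /= ?andbF.
  - by rewrite r12 eqxx (pm _ Hr isT) lt0n !addn_eq0 /= ?andbF.
  - by rewrite r12 eqxx (pm _ Hr isT) lt0n !addn_eq0 /= ?andbF.
rewrite /M !lnnM ?muln_gt0 ?expn_gt0 ?P0 // !lnnX // in LM.
rewrite -[lnn 2]/(ln 2) -[lnn 3]/(ln 3) in LM.
clear -LM LP E1; lra.
Qed.

(* The tangent of ln at 2 ^ 12. *)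
Lemma lnn_le_linear (R : realType) m : (0 < m)%N ->
  lnn m <= m%:R / (2 ^ 12)%:R + 7328 / 1000 :> R.
Proof.
move=> m0; have mR : 0 < m%:R :> R by rewrite ltr0n.
have K0 : 0 < (2 ^ 12)%:R :> R by rewrite ltr0n expn_gt0.
have := ln_le_subr1 (divr_gt0 mR K0).
rewrite ln_div ?posrE // -[ln m%:R]/(lnn m) -[ln (2 ^ 12)%:R]/(lnn (2 ^ 12)) lnnX //.
have /andP[_] := ln2_bounds R; rewrite -[lnn 2]/(ln 2).
move: (ln 2) (lnn m) (m%:R / _) => *; lra.
Qed.

(** The tangent bound for ln (s + 1) reduces this to a quadratic inequality in [s]; 3162 is the
    integer square root of 10^7. *)
Lemma lnn_sqrt_le (R : realType) n s : (3162 <= s)%N -> (s ^ 2 <= n < s.+1 ^ 2)%N ->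
  s.+1%:R * lnn n <= 52 / 10000 * n%:R :> R.
Proof.
move=> s0 /andP[sn ns].
have n0 : (0 < n)%N by apply: leq_trans sn; rewrite expn_gt0 (leq_trans _ s0).
have L1 : lnn n <= 2 * lnn s.+1 :> R.
  by rewrite -[2]/(2%:R) -lnnX // ler_lnn // n0 ltnW.
have L2 := lnn_le_linear R (ltn0Sn s).
have Ls : lnn n <= s.+1%:R / 2048 + 14656 / 1000 :> R.
  move: L1 L2; rewrite natrX; move: (lnn _) (lnn _) (s.+1%:R) => *; lra.
have s0R : 3162 <= s%:R :> R by rewrite ler_nat.
have snR : s%:R ^+ 2 <= n%:R :> R by rewrite -natrX ler_nat.
have : s.+1%:R * lnn n <= s.+1%:R * (s.+1%:R / 2048 + 14656 / 1000) :> R.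
  by rewrite ler_wpM2l.
move/le_trans; apply; rewrite -natr1; clear -s0R snR.
move: (s%:R : R) (n%:R : R) s0R snR => t m t0 H.
apply: (@le_trans _ _ (52 / 10000 * t ^+ 2)); last by rewrite ler_wpM2l //; lra.
have : 0 <= (t - 3162) * (t - 3162) by rewrite mulr_ge0 //; lra.
lra.
Qed.

Lemma theta_ge (R : realType) a n : a \in [:: 1; 5; 7; 11]%N ->
  (10 ^ 7 <= n)%N ->
  135 / 1000 * n%:R <= theta R 12 a (12 * (n %/ 12)).-1.
Proof.
move=> aI n7; set J := (n %/ 12)%N.
have nR : 10 ^+ 7 <= n%:R :> R by rewrite -natrX ler_nat.
have n2 : (3162 ^ 2 <= n)%N by move: n7; clear; lia.
have J0 : (0 < J)%N by rewrite divn_gt0 //; apply: leq_trans n2.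
pose N := (12 * J + 12)%N.
have [s sN] := sqrtn_spec N.
have nN : (n <= N)%N by rewrite /N /J; clear; lia.
have Nn : (N <= n + 12)%N by rewrite /N /J; clear; lia.
have s0 : (3162 <= s)%N.
  case/andP: sN => _ Ns; rewrite -ltnS -(@ltn_exp2r _ _ 2) //.
  by rewrite (leq_ltn_trans n2) // (leq_ltn_trans nN).
have EL := sum_theta_ge R aI J0 (proj2 (andP sN)).
have EN := lnn_sqrt_le R s0 sN.
have LJ : lnn (12 * J) <= lnn N :> R by rewrite ler_lnn // muln_gt0 J0 /N leq_addr.
have NR : N%:R <= n%:R + 12 :> R by rewrite -natrD ler_nat.
have JR : n%:R <= 12 * J%:R + 12 :> R by rewrite -natrM -natrD ler_nat /N.
have v2 : 7 * J%:R <= 8 * (logn 2 J`!)%:R + 24 :> R.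
  by rewrite -!natrM -natrD ler_nat logn2_fact_ge.
have v3 : 4 * J%:R <= 9 * (logn 3 J`!)%:R + 18 :> R.
  by rewrite -!natrM -natrD ler_nat logn3_fact_ge.
have d r : (0 < r)%N -> r%:R * (12 * J %/ r)%:R <= 12 * J%:R :> R.
  by move=> r0; rewrite -!natrM ler_nat mulnC leq_divM.
have T5 := theta_le R (a * 5) (12 * J %/ 5).
have T7 := theta_le R (a * 7) (12 * J %/ 7).
have T11 := theta_le R (a * 11) (12 * J %/ 11).
have d5 := d 5 isT; have d7 := d 7 isT; have d11 := d 11 isT.
have /andP[l2 _] := ln2_bounds R; have /andP[l3 _] := ln3_bounds R.
have J0R : 0 <= J%:R :> R by [].
have E12 := ler_wpM2l J0R l2.
have E13 := ler_wpM2l J0R l3.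
have E2 := ler_wpM2l (ler0n R (logn 2 J`!)) l2.
have E3 := ler_wpM2l (ler0n R (logn 3 J`!)) l3.
rewrite lnn12 mulrDr [_ * (2 * _)]mulrCA in EL.
rewrite -natr1 mulrDl mul1r in EN.
(* Per unit of [n], the main terms give (2.480 + 7/8 * 0.692 + 4/9 * 1.096) / 12 > 0.2977. The
   classes 5a, 7a, 11a cost 0.36 (1/5 + 1/7 + 1/11) < 0.1562, the square root term 0.0052, and the
   three constants 1600 less than 0.0005. *)
clear -nR EL EN LJ NR JR v2 v3 T5 T7 T11 d5 d7 d11 E12 E13 E2 E3.
lra.
Qed.

(** * Large n *)

Lemma sum_pred_le (R : realType) N (Q Q' : pred nat) (F : nat -> R) :
  (forall p, 0 <= F p) -> (forall p, (p < N)%N -> Q p -> Q' p) ->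
  \sum_(p < N | Q p) F p <= \sum_(p < N | Q' p) F p.
Proof.
move=> F0 QQ; rewrite big_mkcond [X in _ <= X]big_mkcond; apply: ler_sum => p _.
by case: ifP => [/(QQ _ (ltn_ord p)) ->//|_]; case: ifP.
Qed.

(* 3.732 bounds ln 12 + ln 2 + ln 3 / 2, and 2.25 bounds 2 + 1 / (q - 1). *)
Lemma sum_square_AP_upper (R : realType) n a q W : prime q -> (4 < q)%N ->
  (n %/ (12 * q ^ 2) < W)%N ->
  \sum_(p < n | [&& prime p, p == a %[mod 12], W < p & q ^ 2 %| n - p]%N) lnn p
   <= (n%:R / (12 * q%:R ^+ 2) + 1) * (3732 / 1000 + 225 / 100 * lnn q) :> R.
Proof.
move=> qpr q4 HW; have q0 := prime_gt0 qpr; set k := (12 * q ^ 2)%N in HW *.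
have c12 := coprime_12_sqr qpr q4.
have q2 : (2 != q)%N by rewrite ltn_eqF // (ltn_trans _ q4).
have q3 : (3 != q)%N by rewrite ltn_eqF // (ltn_trans _ q4).
have k0 : (0 < k)%N by rewrite /k muln_gt0 expn_gt0 q0.
(* The conditions p = a modulo 12 and p = n modulo q^2 form a single class modulo [k]. *)
pose b0 := chinese 12 (q ^ 2) a n.
pose b := if (b0 %% k == 0)%N then k else (b0 %% k)%N.
have bk : (0 < b <= k)%N.
  rewrite /b; case: eqP => [_|/eqP]; first by rewrite k0 leqnn.
  by rewrite -lt0n => ->; rewrite ltnW // ltn_mod.
have bb0 : (b = b0 %[mod k])%N.
  by rewrite /b; case: eqP => [->|_]; rewrite ?modnn ?modn_mod.
pose J := (n %/ k).+1.
have [D ED /= /and4P[c2 c3 cq _]] := @pfactors_split [:: 2; 3; q]%N J`! (fact_gt0 J)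
  ltac:(by rewrite /= !inE negb_or q2 q3) ltac:(by rewrite /= qpr).
have cD : coprime k D.
  by rewrite /k (_ : 12 = 2 * (2 * 3))%N // !coprimeMl c2 c3 cq.
have nJ : (n <= b + k * J)%N.
  by apply: leq_trans (leq_addl _ _); rewrite mulnC ltnW // /J ltn_ceil.
have UP := sum_AP_upper R bk ED cD nJ.
apply: le_trans (le_trans UP _).
  apply: (@sum_pred_le _ _ (fun p => [&& prime p, p == a %[mod 12], W < p & q ^ 2 %| n - p]%N)
     (fun p => [&& prime p, p == b %[mod k] & J < p]%N)).
    by move=> p; exact: lnn_ge0.
  (* Since J <= W, a prime above [W] lies above [J], as the Chebyshev bound demands. *)
  move=> p pn /and4P[-> pa Wp qp]; rewrite (leq_ltn_trans HW Wp) andbT /= bb0.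
  rewrite chinese_remainder // /b0 chinese_modl // chinese_modr // pa /=.
  by rewrite eq_sym eqn_mod_dvd // ltnW.
rewrite !big_cons big_nil muln1 /k !lnnM ?muln_gt0 ?expn_gt0 ?q0 // !lnnX // lnn12.
rewrite -[lnn 2]/(ln 2) -[lnn 3]/(ln 3).
have v2 : ((logn 2 J`!)%:R <= J%:R :> R).
  by rewrite ler_nat; have := @logn_fact_le 2 J isT; rewrite muln1.
have v3 : (2 * (logn 3 J`!)%:R <= J%:R :> R).
  by rewrite -natrM ler_nat mulnC; have := @logn_fact_le 3 J isT.
have vq : (4 * (logn q J`!)%:R <= J%:R :> R).
  rewrite -natrM ler_nat mulnC; apply: leq_trans (logn_fact_le J qpr).
  by rewrite leq_mul2l -ltnS prednK ?q4 ?orbT.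
have JR : J%:R <= n%:R / (12 * q%:R ^+ 2) + 1 :> R.
  rewrite /J -natr1 lerD2r ler_pdivlMr ?mulr_gt0 ?exprn_gt0 ?ltr0n //.
  by rewrite -natrX -!natrM ler_nat leq_divM.
have /andP[l2g l2] := ln2_bounds R; have /andP[l3g l3] := ln3_bounds R.
have Lq := lnn_ge0 R q.
apply: (@le_trans _ _ (J%:R * (3732 / 1000 + 225 / 100 * lnn q))); last first.
  by rewrite ler_wpM2r //; clear -Lq; lra.
have l20 : 0 <= ln 2 :> R by clear -l2g; lra.
have l30 : 0 <= ln 3 :> R by clear -l3g; lra.
have E2 := ler_pM (ler0n R _) l20 v2 l2.
have E3 := ler_pM (mulr_ge0 (ler0n R 2) (ler0n R _)) l30 v3 l3.
have Eq := ler_wpM2r Lq vq.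
have E12 := ler_wpM2l (ler0n R J) l2.
have E13 := ler_wpM2l (ler0n R J) l3.
clear -E2 E3 Eq E12 E13; lra.
Qed.

(* A telescoping majorant: \int_m^oo (A + B ln t) / (2 t ^ 2) dt has this shape;
   the constant 3.16 leaves room for the error of the midpoint rule. *)
Definition square_tail (R : realType) (m : nat) : R :=
  (1125 / 1000 * lnn m + 316 / 100) / m%:R.

Lemma square_tail_ge0 (R : realType) m : 0 <= square_tail R m.
Proof. by rewrite divr_ge0 // addr_ge0 ?mulr_ge0 ?lnn_ge0 //; lra. Qed.

(** The step is 2 because only odd q are summed. Tangent bounds replace the logarithms of q - 1 and
    q + 1 by that of q, which leaves a rational inequality. *)
Lemma square_tail_telescope (R : realType) q : (4 < q)%N ->
  (3732 / 1000 + 225 / 100 * lnn q) / q%:R ^+ 2 <= square_tail R q.-1 - square_tail R q.+1.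
Proof.
move=> q4; rewrite /square_tail.
have q0 : (0 < q)%N by apply: leq_trans q4.
have q1R : (q.-1)%:R = q%:R - 1 :> R by rewrite -subn1 natrB.
have x5 : 5 <= q%:R :> R by rewrite ler_nat.
have x0 : 0 < q%:R :> R by clear -x5; lra.
have xm : 0 < q%:R - 1 :> R by clear -x5; lra.
have xp : 0 < q%:R + 1 :> R by clear -x5; lra.
have l1 : lnn q - (q%:R - 1)^-1 <= lnn q.-1 :> R.
  have := ln_ge1BV (divr_gt0 xm x0); rewrite /lnn q1R ln_div ?posrE // invf_div => H.
  have : 1 - q%:R / (q%:R - 1) = - (q%:R - 1)^-1 :> R by field; lra.
  by move=> E; rewrite E in H; clear -H; lra.
have l2 : lnn q.+1 <= lnn q + (q%:R)^-1 :> R.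
  have := ln_le_subr1 (divr_gt0 xp x0); rewrite /lnn -natr1 ln_div ?posrE // => H.
  have : (q%:R + 1) / q%:R - 1 = (q%:R)^-1 :> R by field; lra.
  by move=> E; rewrite E in H; clear -H; lra.
rewrite q1R -(natr1 q).
have Lq := lnn_ge0 R q.
move: (lnn q) (lnn q.-1) (lnn q.+1) (q%:R : R) Lq l1 l2 x5 x0 xm xp => l a b x l0 l1 l2 x5 x0 xm xp.
apply: (@le_trans _ _ ((1125 / 1000 * (l - (x - 1)^-1) + 316 / 100) / (x - 1)
   - (1125 / 1000 * (l + x^-1) + 316 / 100) / (x + 1))); last first.
  apply: lerB.
    apply: ler_wpM2r; first by rewrite invr_ge0 ltW.
    by clear -l1; lra.
  apply: ler_wpM2r; first by rewrite invr_ge0 ltW.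
  by clear -l2; lra.
rewrite -subr_ge0.
(* The leading coefficient 2 * 3.16 - 3.732 - 2 * 1.125 = 0.338 is positive. *)
have -> : (1125 / 1000 * (l - (x - 1)^-1) + 316 / 100) / (x - 1)
   - (1125 / 1000 * (l + x^-1) + 316 / 100) / (x + 1)
   - (3732 / 1000 + 225 / 100 * l) / x ^+ 2 =
  ((3732 / 1000 + 225 / 100 * l) * (x - 1) + (2588 / 1000 - 2250 / 1000) * x ^+ 2 * (x - 1)
    - 1125 / 1000 * (2 * x ^+ 2 - x * (x - 1))) / (x ^+ 2 * (x - 1) * (x ^+ 2 - 1)).
  field; nra.
rewrite divr_ge0 //.
  nra.
by rewrite !mulr_ge0 //; nra.
Qed.

(** Induction by two, from an empty sum at i = 2: even numbers drop out, each odd q pays one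
    telescoping difference, and the summand 1 costs at most one term with [L]. *)
Lemma sum_squares_le (R : realType) (C L : R) i :
  0 <= C -> (2 <= i)%N -> (forall q, (q < i.*2.+1)%N -> lnn q <= L) ->
  \sum_(q < i.*2.+1 | prime q && (4 < q)%N)
     (C / q%:R ^+ 2 + 1) * (3732 / 1000 + 225 / 100 * lnn q)
  <= C * (square_tail R 4 - square_tail R i.*2) + i%:R * (3732 / 1000 + 225 / 100 * L).
Proof.
move=> C0; case: i => [|[|i]] // _.
have L0 i' : (forall q, (q < i'.+2.*2.+1)%N -> lnn q <= L) -> 0 <= L.
  by move=> H; apply: le_trans (lnn_ge0 R 0) (H 0%N _).
elim: i => [|i IH] HL.
  have {}L0 := L0 _ HL.
  rewrite big1 => [|q /andP[_]]; last by move/leq_trans/(_ (ltn_ord q)).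
  by rewrite subrr mulr0 add0r mulr_ge0 // addr_ge0 ?mulr_ge0 //; lra.
have ii : (i.+2.*2.+1 <= i.+3.*2.+1)%N by rewrite ltnS leq_double.
have {}IH := IH (fun q qi => HL q (leq_trans qi ii)).
have L1 : lnn (i.+2.*2.+1) <= L by apply: HL; rewrite !doubleS.
have E m : \sum_(q < m.+3 | prime q && (4 < q)%N)
    (C / q%:R ^+ 2 + 1) * (3732 / 1000 + 225 / 100 * lnn q) =
  \sum_(q < m.+1 | prime q && (4 < q)%N)
    (C / q%:R ^+ 2 + 1) * (3732 / 1000 + 225 / 100 * lnn q) +
  (if prime m.+1 && (4 < m.+1)%N then
    (C / m.+1%:R ^+ 2 + 1) * (3732 / 1000 + 225 / 100 * lnn m.+1) else 0) +
  (if prime m.+2 && (4 < m.+2)%N then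
    (C / m.+2%:R ^+ 2 + 1) * (3732 / 1000 + 225 / 100 * lnn m.+2) else 0) :> R.
  rewrite big_mkcond [X in _ = X + _ + _]big_mkcond.
  by rewrite 2![in LHS]big_ord_recr.
rewrite doubleS E.
have -> : prime i.+2.*2.+2 = false.
  by apply/negP => /even_prime []; [rewrite !doubleS | rewrite -doubleS odd_double].
rewrite addr0.
have T := square_tail_telescope R (isT : 4 < i.+2.*2.+1)%N.
set g := (C / _ + 1) * _ in IH *.
have Hg : 0 <= g <= C * (square_tail R i.+2.*2 - square_tail R i.+2.*2.+2)
    + (3732 / 1000 + 225 / 100 * L).
  have Lq := lnn_ge0 R i.+2.*2.+1.
  have K0 : 0 <= 3732 / 1000 + 225 / 100 * lnn i.+2.*2.+1 :> R by clear -Lq; lra.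
  apply/andP; split.
    by rewrite mulr_ge0 // addr_ge0 // divr_ge0 // exprn_ge0.
  rewrite /g mulrDl mul1r lerD //; last by clear -L1; lra.
  by rewrite mulrAC -mulrA ler_wpM2l.
have {Hg} /andP[g0 g1] := Hg.
have ifg : (if prime i.+2.*2.+1 && (4 < i.+2.*2.+1)%N then g else 0) <= g.
  by case: ifP.
rewrite -(natr1 i.+2); clear -IH g1 ifg; lra.
Qed.

(** A union bound: each prime is charged to some q, and q <= s because q^2 <= n - p. *)
Lemma sum_window_le (R : realType) n a s W :
  (forall p, prime p -> (p < n)%N -> (p == a %[mod 12])%N ->
     exists q, [/\ prime q, (4 < q)%N & (q ^ 2 %| n - p)%N]) ->
  (n < s.+1 ^ 2)%N ->
  \sum_(p < n | [&& prime p, p == a %[mod 12] & W < p]%N) lnn p <=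
  \sum_(q < s.+1 | prime q && (4 < q)%N)
   \sum_(p < n | [&& prime p, p == a %[mod 12], W < p & q ^ 2 %| n - p]%N) lnn p :> R.
Proof.
move=> bad ns.
under [X in _ <= X]eq_bigr do rewrite big_mkcond.
rewrite exchange_big /= big_mkcond; apply: ler_sum => p _.
case: ifP => [/and3P[pr pa Wp]|_]; last first.
  by apply: sumr_ge0 => q _; case: ifP => // _; exact: lnn_ge0.
have [q [qpr q4 qp]] := bad p pr (ltn_ord p) pa.
have qs : (q < s.+1)%N.
  rewrite -(@ltn_exp2r _ _ 2) //; apply: leq_ltn_trans ns.
  apply: leq_trans (dvdn_leq _ qp) (leq_subr _ _).
  by rewrite subn_gt0.
rewrite (bigD1 (Ordinal qs)) /= ?qpr // pr pa Wp qp /= lerDl.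
by apply: sumr_ge0 => r _; case: ifP => // _; exact: lnn_ge0.
Qed.

Lemma large_case (R : realType) n a :
  (10 ^ 7 <= n)%N -> a \in [:: 1; 5; 7; 11]%N ->
  exists2 p, [/\ prime p, (p < n)%N & (p == a %[mod 12])%N] &
    forall q, prime q -> (4 < q)%N -> ~~ (q ^ 2 %| n - p)%N.
Proof.
move=> n7 aI; apply: contrapT => none.
have bad p : prime p -> (p < n)%N -> (p == a %[mod 12])%N ->
     exists q, [/\ prime q, (4 < q)%N & (q ^ 2 %| n - p)%N].
  move=> pr pn pa; apply: contrapT => nq; apply: none; exists p => // q qpr q4.
  by apply/negP => qp; apply: nq; exists q.
have nR : 10 ^+ 7 <= n%:R :> R by rewrite -natrX ler_nat.
have [s sn] := sqrtn_spec n; have /andP[sn1 ns] := sn.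
have n2 : (3162 ^ 2 <= n)%N by move: n7; clear; lia.
have s0 : (3162 <= s)%N by rewrite -ltnS -(@ltn_exp2r _ _ 2) // (leq_ltn_trans n2).
(* 300 = 12 * 5^2 is the least modulus 12 q^2, so [W] exceeds n / (12 q^2) for every q >= 5, while
   the primes up to [W] weigh little. *)
pose W := (n %/ 300).+1.
have SW := sum_window_le R W bad ns.
pose C : R := n%:R / 12.
have C0 : 0 <= C by rewrite divr_ge0.
have sqn : (s.+3 <= n)%N.
  by apply: leq_trans sn1; rewrite -mulnn; move: s0; clear; nia.
pose i := s./2.+1.
have si : (s.+1 <= i.*2.+1)%N by rewrite /i; move: (odd_double_half s); clear; lia.
have is3 : (i.*2.+1 <= s.+3)%N by rewrite /i; move: (odd_double_half s); clear; lia.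
have is2 : (2 * i <= s.+2)%N by rewrite mul2n -ltnS.
have i2 : (2 <= i)%N by rewrite /i; move: (odd_double_half s) s0; clear; lia.
have Lq q : (q < i.*2.+1)%N -> lnn q <= lnn n :> R.
  case: q => [|q] qi; first by apply: le_trans (lnn_ge0 R n); rewrite /lnn ln0.
  by apply: ler_lnn => //=; apply: ltnW (leq_trans qi (leq_trans is3 sqn)).
have SQ := sum_squares_le C0 i2 Lq.
have ST : \sum_(q < s.+1 | prime q && (4 < q)%N)
   \sum_(p < n | [&& prime p, p == a %[mod 12], W < p & q ^ 2 %| n - p]%N) lnn p <=
   \sum_(q < i.*2.+1 | prime q && (4 < q)%N)
     (C / q%:R ^+ 2 + 1) * (3732 / 1000 + 225 / 100 * lnn q).
  rewrite (big_ord_widen_cond _ (fun q => prime q && (4 < q)%N)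
     (fun q => \sum_(p < n | [&& prime p, p == a %[mod 12], W < p & q ^ 2 %| n - p]%N) lnn p) si).
  rewrite big_mkcond [X in _ <= X]big_mkcond; apply: ler_sum => q _.
  case: ifP => [/andP[/andP[qpr q4] qs]|_].
    rewrite qpr q4 /=.
    have JW : (n %/ (12 * q ^ 2) < W)%N.
      rewrite ltnS leq_div2l // (_ : 300 = 12 * 5 ^ 2)%N //.
      by rewrite leq_pmul2l // leq_exp2r.
    apply: le_trans (sum_square_AP_upper R a qpr q4 JW) _.
    by rewrite /C invfM mulrA.
  case: ifP => // _; have Lq0 := lnn_ge0 R q; apply: mulr_ge0.
    by rewrite addr_ge0 // divr_ge0 // exprn_ge0.
  by clear -Lq0; lra.
have LN := lnn_sqrt_le R s0 sn.
have TG := theta_ge R aI n7.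
have TW := theta_le R a W.
have G0 := square_tail_ge0 R i.*2.
have TS : theta R 12 a (12 * (n %/ 12)).-1 <= theta R 12 a W +
  \sum_(p < n | [&& prime p, p == a %[mod 12] & W < p]%N) lnn p.
  have n100 : (100 <= n)%N by apply: leq_trans n2; clear; lia.
  have WX : (W <= (12 * (n %/ 12)).-1)%N by rewrite /W; clear -n100; lia.
  have Xn : ((12 * (n %/ 12)).-1.+1 <= n)%N by clear -n100; lia.
  rewrite (theta_split R 12 a WX) lerD2l.
  rewrite (big_ord_widen_cond _ (fun p => [&& prime p, p == a %[mod 12] & W < p]%N) lnn Xn).
  pose Q p := [&& prime p, p == a %[mod 12] & W < p]%N.
  apply: (@sum_pred_le _ _ (fun p => Q p && (p < (12 * (n %/ 12)).-1.+1)%N) Q).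
    by move=> p; exact: lnn_ge0.
  by move=> p _ /andP[].
have WR : 300 * W%:R <= n%:R + 300 :> R.
  by rewrite -natrM -natrD ler_nat /W; clear; lia.
have iR : 2 * i%:R <= s%:R + 2 :> R by rewrite -natrM -natrD ler_nat addn2.
have G4 : square_tail R 4 <= 1181 / 1000.
  have l4 : lnn 4 = 2 * ln 2 :> R by rewrite (_ : 4 = 2 ^ 2)%N // lnnX.
  have /andP[_ l2] := ln2_bounds R.
  by rewrite /square_tail l4 ler_pdivrMr //; clear -l2; lra.
have sR : 3162 * s%:R <= n%:R :> R.
  by rewrite -natrM ler_nat (leq_trans _ sn1) // -mulnn leq_mul2r s0 orbT.
have CG : C * (square_tail R 4 - square_tail R i.*2) <= C * (1181 / 1000).
  by rewrite ler_wpM2l //; clear -G4 G0; lra.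
have L0 : 0 <= lnn n :> R by exact: lnn_ge0.
have iL : 2 * (i%:R * lnn n) <= s.+1%:R * lnn n + lnn n :> R.
  rewrite mulrA -[X in _ <= _ + X]mul1r -mulrDl ler_wpM2r //.
  by rewrite -(natr1 s); clear -iR; lra.
have LN' : 3163 * lnn n <= s.+1%:R * lnn n :> R.
  by rewrite ler_wpM2r // ler_nat.
(* Against 0.135 n stand 1.181 n / 12 < 0.0985 n from the squares, about 0.0065 n from the summands
   1 and 0.0014 n from [theta] at [W]: less than 0.107 n in all, a contradiction. *)
have := le_trans TG (le_trans TS (lerD TW (le_trans SW (le_trans ST SQ)))).
rewrite {2}/C in CG.
clear -CG iL LN' LN WR iR sR nR; lra.
Qed.

End Analytic.

(** * Small and medium n *)

(* Boolean masks of initial segments of nat.  [strike d c] clears the positions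
   c, c + d, c + 2 d, ... and [every d c] extracts them; counting down avoids
   unary division. *)
Fixpoint strike (d c : nat) (s : seq bool) : seq bool :=
  if s is x :: s' then
    if c is c'.+1 then x :: strike d c' s' else false :: strike d d.-1 s'
  else [::].

Fixpoint every (d c : nat) (s : seq bool) : seq bool :=
  if s is x :: s' then
    if c is c'.+1 then every d c' s' else x :: every d d.-1 s'
  else [::].

Definition primes_upto r := [seq p <- iota 0 r.+1 | prime p].

(** Primes up to [r] are struck together with their multiples; for Y <= (r + 1)^2 exactly the primes
    above [r] and below [Y] remain. *)
Definition sieve r Y :=
  foldr (fun d s => strike d 0 s) [:: false, false & nseq (Y - 2) true]
    (primes_upto r).

(* The primes q > r have q ^ 2 > J in all uses, so that each of them kills at most
   one prime. *)
Definition bad_bound J r Q sv :=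
  sumn [seq J %/ q ^ 2 + 1 | q <- primes_upto r & 4 < q] + count id (take Q.+1 sv).

Definition medium_check J r Q :=
  let sv := sieve r (12 * J) in
  let B := bad_bound J r Q sv in
  all (fun a => B < count id (every 12 a sv)) [:: 1; 5; 7; 11].

Lemma nth_strike d c s j : 0 < d ->
  nth false (strike d c s) j = nth false s j && ~~ ((c <= j) && (d %| j - c)).
Proof.
move=> d0; elim: s c j => [|x s IH] c j; first by rewrite !nth_nil.
case: c j => [|c] [|j] //=; rewrite ?dvdn0 ?andbF ?andbT // IH.
  congr (_ && ~~ _); rewrite subn0; have [dj|jd] := leqP d.-1 j.
    have dj' : d <= j.+1 by rewrite -(prednK d0) ltnS.
    have -> : j - d.-1 = j.+1 - d by rewrite -{2}(prednK d0) subSS.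
    by rewrite -[in RHS](subnK dj') dvdn_addl.
  rewrite /=; apply/esym/negbTE/negP => /dvdn_leq => /(_ isT).
  by rewrite leqNgt -[d in _ < d](prednK d0) ltnS jd.
by rewrite subSS ltnS.
Qed.

Lemma nth_every d c s j : 0 < d -> nth false (every d c s) j = nth false s (c + d * j).
Proof.
move=> d0; elim: s c j => [|x s IH] c j; first by rewrite !nth_nil.
case: c j => [|c] [|j] //=; rewrite ?IH ?muln0 ?add0n ?addn0 //.
by have -> : d * j.+1 = (d.-1 + d * j).+1 by rewrite mulnS -addSn prednK.
Qed.

Lemma mem_primes_upto r p : (p \in primes_upto r) = prime p && (p <= r).
Proof. by rewrite mem_filter mem_iota ltnS. Qed.

Lemma nth_sieve r Y m :
  nth false (sieve r Y) m =
  [&& 1 < m, m < Y & all (fun d => ~~ (d %| m)) (primes_upto r)].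
Proof.
rewrite /sieve; have : all prime (primes_upto r) by exact: filter_all.
elim: primes_upto => [|d s IH] /=.
  by case: m => [|[|m]] //=; rewrite nth_nseq ltn_subRL andbT; case: ifP.
case/andP=> dpr /IH {}IH; rewrite nth_strike ?prime_gt0 // IH subn0 /=.
by rewrite -!andbA; do 2 congr (_ && _); rewrite andbC.
Qed.

Lemma sieve_prime r Y m : Y <= r.+1 ^ 2 -> nth false (sieve r Y) m -> prime m.
Proof.
move=> Yr; rewrite nth_sieve => /and3P[m1 mY /allP H].
apply: contraLR mY => np; rewrite -leqNgt (leq_trans Yr) //.
have pm := pdiv_prime m1; rewrite leqNgt; apply/negP => mr.
have /H : pdiv m \in primes_upto r; last by rewrite pdiv_dvd.
rewrite mem_primes_upto pm -ltnS -(@ltn_exp2r _ _ 2) //.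
apply: leq_ltn_trans mr; rewrite leqNgt; apply/negP => mp.
by move/negP: np; apply; apply: ltn_pdiv2_prime => //; exact: ltnW.
Qed.

Lemma sum_count_mask (s : seq bool) N (Q : pred nat) :
  (forall q, q < N -> Q q -> nth false s q) ->
  \sum_(q < N) Q q <= count id (take N s).
Proof.
elim: N s Q => [|N IH] s Q H; first by rewrite big_ord0.
rewrite big_ord_recl; case: s H => [|x s] H /=.
  rewrite leqn0 addn_eq0 sum_nat_eq0; apply/andP; split.
    by rewrite eqb0; apply/negP => /(H 0 isT).
  apply/forallP => i; rewrite eqb0; apply/negP => Qi.
  by have := H _ (ltn_ord (lift ord0 i)) Qi; rewrite nth_nil.
apply: leq_add; first by case: (Q 0) (H 0 isT) => //= /(_ isT) ->.
by apply: (IH s (fun q => Q q.+1)) => q qN; exact: (H q.+1).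
Qed.

(** For q > r the quotient J / q^2 vanishes, and the remaining 1 is counted by the mask, which still
    contains every prime above [r] and up to [Q]. *)
Lemma bad_bound_ge J r Q Y : J < r.+1 ^ 2 -> Q < Y ->
  \sum_(q < Q.+1 | prime q && (4 < q)) (J %/ q ^ 2).+1 <= bad_bound J r Q (sieve r Y).
Proof.
move=> Jr QY; pose K := maxn Q.+1 r.+1.
rewrite /bad_bound sumnE big_map big_filter /primes_upto big_filter_cond.
pose G q := if prime q && (4 < q) then (J %/ q ^ 2).+1 else 0.
apply: (@leq_trans (\sum_(q < Q.+1) ((if q <= r then G q else 0) +
                                      (prime q && (r < q))))).
  rewrite big_mkcond; apply: leq_sum => q _; rewrite /G.
  have [qr|rq] := leqP q r; first exact: leq_addr.
  case: ifP => // /andP[-> _]; rewrite add0n ltnS leqn0.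
  by rewrite divn_small // (leq_trans Jr) // leq_exp2r.
rewrite big_split leq_add //; last first.
  apply: (sum_count_mask (Q := fun q => prime q && (r < q))) => q qQ /andP[pr rq].
  rewrite nth_sieve prime_gt1 // (leq_ltn_trans _ QY) //=.
  apply/seq.allP => d; rewrite mem_primes_upto => /andP[dpr dr].
  by rewrite dvdn_prime2 // neq_ltn (leq_ltn_trans dr rq).
rewrite -(big_mkord predT (fun q => if q <= r then G q else 0)).
apply: (@leq_trans (\sum_(0 <= q < K) if q <= r then G q else 0)).
  by rewrite [X in _ <= X](@big_cat_nat _ _ _ Q.+1) //= ?leq_maxl // leq_addr.
rewrite (@big_cat_nat _ _ _ r.+1) //= ?leq_maxr // [X in _ + X]big_nat_cond.
rewrite [X in _ + X]big1 ?addn0; last first.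
  by move=> q /andP[/andP[rq _] _]; rewrite leqNgt rq.
rewrite /index_iota subn0 [X in _ <= X]big_mkcond; apply: leq_sum => q _.
by rewrite /G addn1; case: ifP.
Qed.

Lemma count_le_sum_nth (s : seq bool) N :
  (forall j, N <= j -> nth false s j = false) ->
  count id s <= \sum_(j < N) nth false s j.
Proof.
elim: s N => [|x s IH] N H //=; case: N H => [|N] H.
  rewrite (H 0 isT : x = false) add0n big_ord0.
  by have := IH 0 (fun j _ => H j.+1 isT); rewrite big_ord0.
rewrite big_ord_recl leq_add2l; apply: IH => j Nj; exact: (H j.+1).
Qed.

(** Pigeonhole: the indices killed by q are congruent modulo q^2, so there are at most J / q^2 + 1
    of them, and n < (Q + 1)^2 forces q <= Q. The class has more sieved primes than these bounds add
    up to. *)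
Lemma medium_case n a J r Q : medium_check J r Q -> a \in [:: 1; 5; 7; 11] ->
  12 * J <= r.+1 ^ 2 -> Q < 12 * J -> 12 * J <= n -> n < Q.+1 ^ 2 ->
  exists2 p, [/\ prime p, p < n & p == a %[mod 12]] &
    forall q, prime q -> 4 < q -> ~~ (q ^ 2 %| n - p).
Proof.
move=> /seq.allP/(_ a) H aI Yr QY Yn nQ; have {H} := H aI.
set sv := sieve r (12 * J); set B := bad_bound _ _ _ _ => HB.
apply: contrapT => none.
pose S := [pred j : 'I_J | nth false sv (a + 12 * j)].
have a12 : a < 12 by move: aI; rewrite !inE => /or4P[] /eqP ->.
have bad (j : 'I_J) : S j -> exists q : 'I_Q.+1,
    [&& prime q, 4 < q & q ^ 2 %| n - (a + 12 * j)].
  move=> Sj; have pr := sieve_prime Yr Sj.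
  have pn : a + 12 * j < n.
    by apply: leq_trans Yn; have := ltn_ord j; clear -a12; lia.
  apply: contrapT => nq; apply: none; exists (a + 12 * j).
    by split=> //; rewrite addnC mulnC modnMDl.
  move=> q qpr q4; apply/negP => qp; apply: nq.
  have qQ : q < Q.+1.
    rewrite -(@ltn_exp2r _ _ 2) //; apply: leq_ltn_trans nQ.
    by apply: leq_trans (dvdn_leq _ qp) (leq_subr _ _); rewrite subn_gt0.
  by exists (Ordinal qQ); rewrite qpr q4.
have SB : #|S| <= B.
  apply: (@leq_trans (\sum_(q < Q.+1 | prime q && (4 < q)) (J %/ q ^ 2).+1)); last first.
    by apply: bad_bound_ge => //; apply: leq_trans Yr; clear -QY; lia.
  apply: (@leq_trans (\sum_(q < Q.+1 | prime q && (4 < q))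
     #|[pred j : 'I_J | S j && (q ^ 2 %| n - (a + 12 * j))]|)).
    rewrite -sum1_card; under [X in _ <= X]eq_bigr do rewrite -sum1_card big_mkcond.
    rewrite exchange_big big_mkcond /=; apply: leq_sum => j _; case: ifP => // /[!inE] Sj.
    have [q /and3P[qpr q4 qp]] := bad j Sj.
    by rewrite (bigD1 q) /= ?qpr //= inE Sj qp.
  apply: leq_sum => q /andP[qpr q4]; apply: card_congr_le.
    by rewrite expn_gt0 prime_gt0.
  move=> i j /andP[Si qi] /andP[Sj qj].
  have iJ k : a + 12 * (k : 'I_J) <= n.
    by apply: leq_trans Yn; have := ltn_ord k; clear -a12; lia.
  apply: (@eqn_mod_coprime _ 12); first by rewrite coprime_sym coprime_12_sqr.
  move: qi qj; rewrite -!eqn_mod_dvd // => /eqP qi /eqP qj.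
  by apply/eqP; rewrite -(eqn_modDl a) -qi -qj.
have SC : count id (every 12 a sv) <= #|S|.
  apply: leq_trans (count_le_sum_nth (N := J) _) _ => [j Jj|].
    rewrite nth_every // nth_sieve; apply/and3P => -[_ + _].
    by rewrite ltnNge -[X in ~~ X]negbK (_ : 12 * J <= a + 12 * j) //; clear -Jj; lia.
  rewrite -sum1_card [X in _ <= X]big_mkcond; apply: leq_sum => j _.
  by rewrite nth_every // !inE; case: nth.
by move: HB; rewrite ltnNge (leq_trans SC SB).
Qed.

(** For n < 600 the difference is below 25^2, so primes up to 24 decide square-freeness; a prime p
    <= 61 always suffices. *)
Definition small_check :=
  all (fun n => (n == 11) || has (fun p => [&& p < n, coprime (n - p) 3 &
      all (fun q => ~~ (q ^ 2 %| n - p)) (primes_upto 24)]) (primes_upto 61))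
    (iota 3 597).

Lemma small_case n : 2 < n < 600 -> n <> 11 ->
  exists2 p, [/\ prime p, p < n & coprime (n - p) 3] &
    forall q, prime q -> ~~ (q ^ 2 %| n - p).
Proof.
move=> /andP[n2 n600] n11; have : small_check by vm_compute.
move/seq.allP/(_ n); rewrite mem_iota n2 n600 => /(_ isT).
case/orP => [/eqP //|/hasP[p]]; rewrite mem_primes_upto => /andP[pr _].
case/and3P => pn cp /seq.allP sq; exists p => // q qpr.
have [q24|q24] := leqP q 24; first by apply: sq; rewrite mem_primes_upto qpr.
apply/negP => /dvdn_leq; rewrite subn_gt0 pn => /(_ isT).
rewrite leqNgt (leq_ltn_trans (leq_subr _ _)) // (leq_trans n600) //.
by rewrite (@leq_trans (25 ^ 2)) // leq_exp2r.
Qed.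

(** * Choice of the class and conclusion *)

Lemma class12_avoiding n : exists2 a, a \in [:: 1; 5; 7; 11] &
  (a != n %[mod 3]) && (a != n %[mod 4]).
Proof.
(* There are two units modulo 3 and two modulo 4, so one of each differs from [n]; the four classes
   realize every combination. *)
have : all (fun r => has (fun a => (a != r %[mod 3]) && (a != r %[mod 4]))
  [:: 1; 5; 7; 11]) (iota 0 12) by [].
move/(elimT seq.allP)/(_ (n %% 12)); rewrite mem_iota ltn_mod => /(_ isT).
case/hasP => a aI; rewrite !modn_dvdm // => H; by exists a.
Qed.

Lemma squarefree_of_class n a p : a != n %[mod 3] -> a != n %[mod 4] ->
  p < n -> p == a %[mod 12] ->
  (forall q, prime q -> 4 < q -> ~~ (q ^ 2 %| n - p)) ->
  squarefree (n - p) /\ coprime (n - p) 3.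
Proof.
move=> a3 a4 pn pa H.
have red d : d %| 12 -> d %| n - p -> a == n %[mod d].
  move=> d12; rewrite -eqn_mod_dvd ?(ltnW pn) // => /eqP ->.
  by rewrite -(modn_dvdm a d12) -(modn_dvdm p d12) (eqP pa).
have n3 : ~~ (3 %| n - p) by apply: contra a3; exact: red.
split; last by rewrite coprime_sym prime_coprime.
split; first by rewrite subn_gt0.
move=> q qpr; have [q4|q4] := ltnP 4 q; first exact: H.
have : q \in [:: 2; 3] by case: q qpr q4 => [|[|[|[|[|]]]]].
rewrite !inE => /orP[] /eqP ->; first by apply: contra a4; exact: red.
by apply: contra n3; apply: dvdn_trans.
Qed.

Theorem theorem4 (n : nat) (hn : 2 < n) :
  (exists p eta : nat,
     [/\ prime p, squarefree eta, coprime eta 3 & n = p + eta]) <-> n <> 11.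
Proof.
split=> [[p [eta [pr [eta0 sq] c3 E]]] n11|n11].
  have p11 : p <= 11 by rewrite -n11 E leq_addr.
  have {E} Eeta : eta = 11 - p by rewrite -n11 E addKn.
  (* For n = 11 the primes 2, 3, 5, 7, 11 leave 9, 8, 6, 4, 0, none of which is admissible. *)
  move: (sq 2 isT) (sq 3 isT); subst eta; clear sq n11 hn.
  by move: pr p11 eta0 c3; do 12 (case: p => [|p] //).
have [n600|n600] := ltnP n 600.
  have n2600 : 2 < n < 600 by rewrite hn.
  have [p [pr pn c3] sq] := small_case n2600 n11.
  exists p, (n - p); split=> //; last by rewrite subnKC // ltnW.
  by split; rewrite // subn_gt0.
have [a aI /andP[a3 a4]] := class12_avoiding n.
suff [p [pr pn pa] H] : exists2 p, [/\ prime p, p < n & p == a %[mod 12]] &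
    forall q, prime q -> 4 < q -> ~~ (q ^ 2 %| n - p).
  have [sq c3] := squarefree_of_class a3 a4 pn pa H.
  by exists p, (n - p); split=> //; rewrite subnKC // ltnW.
(* A table up to Y = 12 J needs Y <= (r + 1)^2 and serves Y <= n < (Q + 1)^2. Tables up to 600, 3000
   and 29928 serve below 55^2 = 3025, 173^2 = 29929 and 3163^2 > 10^7, so the ranges overlap. *)
have [n1|n1] := ltnP n (55 ^ 2).
  have c : medium_check 50 24 54 by vm_compute.
  by apply: (medium_case c aI); move: n600 n1; clear; lia.
have [n2|n2] := ltnP n (173 ^ 2).
  have c : medium_check 250 54 172 by vm_compute.
  by apply: (medium_case c aI); move: n1 n2; clear; lia.
have [n3|n3] := leqP (10 ^ 7) n.
  exact: (large_case Rdefinitions.R n3 aI).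
have c : medium_check 2494 172 3162 by vm_compute.
apply: (medium_case c aI); move: n2 n3; clear; lia.
Qed.
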